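(* Let $c,\beta,\sigma_h^2>0$, $0<r_{\mathrm{ex}}<r_{\mathrm{net}}$, and let $\alpha\ge 2$ be the path-loss exponent. Let $P=c\beta D^{-\alpha}|h|^2$, where $D$ is the distance from the center of a point uniformly distributed in the annulus of inner radius $r_{\mathrm{ex}}$ and outer radius $r_{\mathrm{net}}$, and $|h|^2$ is independent of $D$ and exponentially distributed with mean $\sigma_h^2$. Then the average output DC power under round-robin scheduling is $$\overline{P_{\mathrm{rrs}}^{\mathrm{het}}}=\mathbb{E}[P]=\frac{2c\beta\sigma_h^2}{(\alpha-2)(r_{\mathrm{net}}^2-r_{\mathrm{ex}}^2)}\left(r_{\mathrm{ex}}^{2-\alpha}-r_{\mathrm{net}}^{2-\alpha}\right).$$ When $r_{\mathrm{net}}\gg r_{\mathrm{ex}}$, this is approximated by $$\overline{P_{\mathrm{rrs}}^{\mathrm{het}}}\approx c\beta\sigma_h^2\,r_{\mathrm{ex}}^{-\alpha}\cdot\frac{2}{\alpha-2}\left(\frac{r_{\mathrm{ex}}}{r_{\mathrm{net}}}\right)^2,$$ where the factor $c\beta\sigma_h^2 r_{\mathrm{ex}}^{-\alpha}$ is the round-robin average output DC power of users all at the shortest distance $r_{\mathrm{ex}}$, and $\frac{2}{\alpha-2}(r_{\mathrm{ex}}/r_{\mathrm{net}})^2$ is a power scaling factor expressing the effect of path-loss variety among users. Setting this approximate value equal to the round-robin average output DC power $c\beta\sigma_h^2\,\bar d^{-\alpha}$ of users all located at a common distance $\bar d$ from the beacon yields $$\bar d=r_{\mathrm{ex}}\left[\frac{\alpha-2}{2}\left(\frac{r_{\mathrm{net}}}{r_{\mathrm{ex}}}\right)^2\right]^{1/\alpha}.$$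 That is, under round-robin scheduling, the average output DC power of the users spread over the annulus is equivalent to that of symmetric users at distance $\bar d$, the bracketed factor (with its exponent $1/\alpha$) being a distance scaling factor relative to $r_{\mathrm{ex}}$.
   Context: Model: a power beacon at the center of the annulus transmits power wirelessly to users; $P$ is the instantaneous output DC power of a user. The constant $c>0$ depends on the rectifier parameters and is proportional to the beacon's effective radiated power, $\beta>0$ is a constant scaling factor, and $|h|^2$ is the Rayleigh fading gain. Under round-robin scheduling users are served in periodic turns, and the average output DC power is the mean output power of a single user; for users all at the same distance $d$ it equals $c\beta\sigma_h^2 d^{-\alpha}$. The symbol $\approx$ denotes an (informal) approximation valid when $r_{\mathrm{net}}$ is much larger than $r_{\mathrm{ex}}$.
   Formalization: At α = 2 the closed form is 0/0 and the approximation contains 2/0; the formal statement takes the formulas for α > 2, reads the closed form at α = 2 as its limit in α, and states the approximation and the equivalent distance only for α > 2. *)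

(* Defs.v *)
From HB Require Import structures.
From mathcomp Require Import all_boot all_order all_algebra.
From mathcomp Require Import all_classical all_reals all_analysis.

Set Implicit Arguments.
Unset Strict Implicit.
Unset Printing Implicit Defensive.

Import Order.TTheory GRing.Theory Num.Theory.
Import numFieldNormedType.Exports.

Local Open Scope classical_set_scope.
Local Open Scope ring_scope.

(* The beacon sits at the origin of the plane R * R. *)
Definition beacon_distance (R : realType) (z : R * R) : R :=
  Num.sqrt (z.1 ^+ 2 + z.2 ^+ 2).

Definition annulus (R : realType) (rin rout : R) : set (R * R) :=
  [set z | rin <= beacon_distance z <= rout].

Definition plane_area (R : realType) : set (R * R) -> \bar R :=
  (@lebesgue_measure R \x @lebesgue_measure R)%E.

(* Meaningful when [D] is measurable with positive and finite area; this is
   the case of [annulus rin rout] as soon as [0 < rin < rout]. *)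
Definition uniform_in (d : measure_display) (T : measurableType d)
    (R : realType) (P : probability T R) (Z : {RV P >-> (R * R)%type})
    (D : set (R * R)) : Prop :=
  forall B : set (R * R), measurable B ->
    distribution P Z B = (fine (plane_area (B `&` D)) / fine (plane_area D))%:E.

(* [exponential_prob] takes the rate, i.e., the inverse of the mean. *)
Definition exponential_with_mean (d : measure_display) (T : measurableType d)
    (R : realType) (P : probability T R) (G : {RV P >-> R}) (m : R) : Prop :=
  forall B : set R, measurable B -> distribution P G B = exponential_prob m^-1 B.

Definition independent_rv (d : measure_display) (T : measurableType d)
    (R : realType) (P : probability T R) (X Y : T -> R) : Prop :=
  forall A B : set R, measurable A -> measurable B ->
    P (X @^-1` A `&` Y @^-1` B) = (P (X @^-1` A) * P (Y @^-1` B))%E.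

(* A user at the random location [Z] whose fading gain [|h|^2] is [G];
   [sigma2] stands for [sigma_h^2]. *)
Definition annulus_user (d : measure_display) (T : measurableType d)
    (R : realType) (P : probability T R) (Z : {RV P >-> (R * R)%type})
    (G : {RV P >-> R}) (sigma2 rex rnet : R) : Prop :=
  [/\ uniform_in Z (annulus rex rnet),
      exponential_with_mean G sigma2 &
      independent_rv P (@beacon_distance R \o Z) G].

(* Instantaneous output DC power at the random distance [D], with gain [G]. *)
Definition output_power (T : Type) (R : realType) (c beta alpha : R)
    (D G : T -> R) : T -> R :=
  fun w => c * beta * D w `^ (- alpha) * G w.

(* Users are served in periodic turns and are statistically identical, so the
   average is the mean output power of a single user. *)
Definition rrs_average (d : measure_display) (T : measurableType d)
    (R : realType) (P : probability T R) (Pout : T -> R) : \bar R :=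
  'E_P[Pout].

(* This has a removable singularity at [alpha = 2]; [x / 0] being [0], its
   value there is not meaningful. *)
Definition het_formula (R : realType) (c beta sigma2 rex rnet alpha : R) : R :=
  2 * c * beta * sigma2 / ((alpha - 2) * (rnet ^+ 2 - rex ^+ 2))
  * (rex `^ (2 - alpha) - rnet `^ (2 - alpha)).

Definition power_scaling (R : realType) (alpha rex rnet : R) : R :=
  2 / (alpha - 2) * (rex / rnet) ^+ 2.

Definition het_approx (R : realType) (c beta sigma2 rex rnet alpha : R) : R :=
  c * beta * sigma2 * rex `^ (- alpha) * power_scaling alpha rex rnet.

Definition distance_scaling (R : realType) (alpha rex rnet : R) : R :=
  ((alpha - 2) / 2 * (rnet / rex) ^+ 2) `^ (alpha^-1).

(* Main.v *)
Require Import Defs.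
From HB Require Import structures.
From mathcomp Require Import all_boot all_order all_algebra.
From mathcomp Require Import all_classical all_reals all_analysis.
From mathcomp Require Import measurable_realfun lra ring.

Set Implicit Arguments.
Unset Strict Implicit.
Unset Printing Implicit Defensive.

Import Order.TTheory GRing.Theory Num.Theory.
Import numFieldNormedType.Exports.

Local Open Scope classical_set_scope.
Local Open Scope ring_scope.

(* By the scaling of the plane measure, the disk of radius r has area kappa r^2,
   where kappa is the area of the unit disk, whose value is irrelevant.  Hence
   P(D < r) = (r^2 - rex^2) / (rnet^2 - rex^2) on [rex, rnet], which gives the
   tail function of D^(-alpha); integrating it yields E[D^(-alpha)], and
   E[D^(-alpha) |h|^2] factors by independence.  With rho = rnet / rex, the
   ratio of the exact average to the approximation is
   (1 - rho^(2 - alpha)) / (1 - rho^(-2)), which tends to 1. *)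

(** * Areas of disks and annuli *)

(** The push-forward of Lebesgue measure along multiplication by [r], rescaled by [r], agrees with
    Lebesgue measure on half-open intervals, hence on all measurable sets. *)
Lemma lebesgue_measure_dilation (R : realType) (r : R) (A : set R) : 0 < r ->
  measurable A ->
  (lebesgue_measure [set x | A (r * x)%R] = r^-1%:E * lebesgue_measure A)%E.
Proof.
move=> r0 mA.
have mr : measurable_fun setT (( *%R r) : measurableTypeR R -> measurableTypeR R).
  exact: measurable_funM.
pose f : measurableTypeR R -> measurableTypeR R := *%R r.
pose rn : {nonneg R} := NngNum (ltW r0).
pose nu : {measure set (measurableTypeR R) -> \bar R} :=
  mscale rn (pushforward lebesgue_measure f).
have H : forall B, measurable B -> lebesgue_measure B = nu mr B.
  apply: lebesgue_measure_unique => _ [[a b] _ <-].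
  rewrite /nu/= /mscale/= /pushforward.
  rewrite [X in (_ * lebesgue_measure X)%E](_ : _ = `](r^-1 * a), (r^-1 * b)]%classic); last first.
    by apply/seteqP; split => x /=; rewrite !in_itv/= ltr_pdivrMl// ler_pdivlMl//.
  rewrite !lebesgue_measure_itv/= !lte_fin ltr_pM2l ?invr_gt0//.
  case: ifP => _; last by rewrite mule0.
  by rewrite -!EFinB -EFinM -mulrBr mulrA divff ?mul1r ?gt_eqF.
by rewrite (H A)// /nu/= /mscale/= muleA -EFinM mulVf ?gt_eqF// mul1e.
Qed.

Lemma measurable_beacon_distance (R : realType) :
  measurable_fun setT (@beacon_distance R).
Proof.
apply: (measurableT_comp (f := @Num.sqrt R)); last first.
  by apply: measurable_funD; apply: measurable_funX.
apply: continuous_measurable_fun; exact: sqrt_continuous.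
Qed.

(** Same argument in the plane: by uniqueness of the product measure it is enough to compare on
    rectangles, where each side scales by the one-dimensional lemma. *)
Lemma plane_area_dilation (R : realType) (r : R) (A : set (R * R)) : 0 < r ->
  measurable A ->
  (plane_area [set z | A ((r * z.1)%R, (r * z.2)%R)] = (r ^- 2)%:E * plane_area A)%E.
Proof.
move=> r0 mA.
pose R2 := (measurableTypeR R * measurableTypeR R)%type.
pose f1 := *%R r : R -> R.
pose f : R2 -> R2 := fun z => (r * z.1, r * z.2).
have mr : measurable_fun setT f.
  by apply/measurable_fun_pairP; split; exact: measurable_funM.
pose rn : {nonneg R} := NngNum (ltW (exprn_gt0 2 r0)).
pose nu : {measure set R2 -> \bar R} :=
  mscale rn (pushforward (lebesgue_measure \x lebesgue_measure)%E f).
have H : forall B, measurable B -> plane_area B = nu mr B.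
  apply: (@product_measure_unique _ _ (measurableTypeR R) (measurableTypeR R) R
    lebesgue_measure lebesgue_measure (nu mr)) => B C mB mC.
  rewrite /nu/= /mscale/= /pushforward.
  have -> : f @^-1` (B `*` C) =
      [set x | B (r * x)] `*` [set x | C (r * x)].
    by [].
  have mD E : measurable E -> measurable [set x : measurableTypeR R | E (r * x)].
    move=> mE; rewrite -[X in measurable X]setTI.
    suff : measurable_fun setT (f1 : measurableTypeR R -> measurableTypeR R) by exact.
    exact: measurable_funM.
  rewrite product_measure1E; [|exact: mD..] => /=.

  rewrite !lebesgue_measure_dilation// muleACA !muleA -!EFinM.
  by rewrite expr2 mulfK ?divff ?mul1e// gt_eqF.
rewrite (H A)// /nu/= /mscale/= muleA -EFinM mulVf ?mul1e//.
by rewrite gt_eqF ?exprn_gt0.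
Qed.

(** Both kinds of disk occur: the annulus is a closed disk minus an open one, while the tail event
    of D^(-alpha) is a strict inequality D < r. *)
Definition open_disk (R : realType) (r : R) : set (R * R) :=
  [set z | beacon_distance z < r].

Definition closed_disk (R : realType) (r : R) : set (R * R) :=
  [set z | beacon_distance z <= r].

Lemma beacon_distance_ge0 (R : realType) (z : R * R) : 0 <= beacon_distance z.
Proof. exact: sqrtr_ge0. Qed.

Lemma beacon_distance_dilation (R : realType) (r : R) (z : R * R) : 0 <= r ->
  beacon_distance (r * z.1, r * z.2) = r * beacon_distance z.
Proof.
move=> r0; rewrite /beacon_distance/= !exprMn -mulrDr sqrtrM ?sqr_ge0//.
by rewrite sqrtr_sqr ger0_norm.
Qed.

Lemma measurable_open_disk (R : realType) (r : R) : measurable (open_disk r).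
Proof.
have := @measurable_beacon_distance R measurableT _ (measurable_itv `]-oo, r[).
by rewrite setTI.
Qed.

Lemma measurable_closed_disk (R : realType) (r : R) :
  measurable (closed_disk r).
Proof.
have := @measurable_beacon_distance R measurableT _ (measurable_itv `]-oo, r]).
by rewrite setTI.
Qed.

(** The unit disk is the preimage of the disk of radius [r] under the dilation by [r]. *)
Lemma plane_area_open_disk1 (R : realType) (r : R) : 0 < r ->
  (plane_area (open_disk r) = (r ^+ 2)%:E * plane_area (open_disk (1 : R)))%E.
Proof.
move=> r0.
have -> : open_disk (1 : R) = [set z | open_disk r (r * z.1, r * z.2)].
  apply/seteqP; split => z; rewrite /open_disk/= beacon_distance_dilation ?(ltW r0)//;
    by rewrite gtr_pMr.
rewrite plane_area_dilation//; last exact: measurable_open_disk.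
by rewrite muleA -EFinM divff ?mul1e// gt_eqF// exprn_gt0.
Qed.

Lemma plane_area_closed_disk1 (R : realType) (r : R) : 0 < r ->
  (plane_area (closed_disk r) = (r ^+ 2)%:E * plane_area (closed_disk (1 : R)))%E.
Proof.
move=> r0.
have -> : closed_disk (1 : R) = [set z | closed_disk r (r * z.1, r * z.2)].
  apply/seteqP; split => z; rewrite /closed_disk/= beacon_distance_dilation ?(ltW r0)//;
    by rewrite ger_pMr.
rewrite plane_area_dilation//; last exact: measurable_closed_disk.
by rewrite muleA -EFinM divff ?mul1e// gt_eqF// exprn_gt0.
Qed.

Lemma le_plane_area (R : realType) (A B : set (R * R)) :
  measurable A -> measurable B -> A `<=` B -> (plane_area A <= plane_area B)%E.
Proof.
move=> mA mB AB; rewrite /plane_area.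
by apply: le_measure; rewrite ?inE.
Qed.

Lemma plane_area_rectangle (R : realType) (a b c d : R) : a < b -> c < d ->
  plane_area (`[a, b]%classic `*` `[c, d]%classic) = ((b - a) * (d - c))%:E.
Proof.
move=> ab cd; rewrite /plane_area product_measure1E//=.
by rewrite !lebesgue_measure_itv/= !lte_fin ab cd -!EFinB -EFinM.
Qed.

(** The constant kappa; [fine] loses nothing here, by [plane_area_open_disk1_fin]. *)
Definition unit_disk_area (R : realType) : R :=
  fine (plane_area (open_disk (1 : R))).

(** The closed unit disk is contained in the square of side 2 centered at the origin. *)
Lemma plane_area_closed_disk1_fin (R : realType) :
  plane_area (closed_disk (1 : R)) \is a fin_num.
Proof.
rewrite ge0_fin_numE; last by rewrite /plane_area measure_ge0.
apply: (@le_lt_trans _ _ (plane_area (`[(-1):R, 1]%classic `*` `[(-1):R, 1]%classic))).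
  apply: le_plane_area; first exact: measurable_closed_disk.
    exact: measurableX.
  have le1 (x y : R) : Num.sqrt (x ^+ 2 + y ^+ 2) <= 1 -> -1 <= x <= 1.
    move=> h; rewrite -ler_norml -sqrtr_sqr (le_trans _ h)// ler_wsqrtr//.
    by rewrite lerDl sqr_ge0.
  move=> z; rewrite /closed_disk/= /beacon_distance => h.
  by split; rewrite /= in_itv/=; [apply: le1 h|rewrite addrC in h; apply: le1 h].
by rewrite plane_area_rectangle ?ltry// gtrN.
Qed.

Lemma plane_area_open_disk1_fin (R : realType) :
  plane_area (open_disk (1 : R)) \is a fin_num.
Proof.
rewrite ge0_fin_numE; last by rewrite /plane_area measure_ge0.
apply: (@le_lt_trans _ _ (plane_area (closed_disk (1 : R)))).
  apply: le_plane_area; [exact: measurable_open_disk|exact: measurable_closed_disk|].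
  by move=> z /ltW.
by rewrite -ge0_fin_numE ?plane_area_closed_disk1_fin// /plane_area measure_ge0.
Qed.

(** The open unit disk contains the square [0, 1/2]^2, on which the squared distance is at most
    1/2. *)
Lemma unit_disk_area_gt0 (R : realType) : 0 < unit_disk_area R.
Proof.
rewrite -lte_fin /unit_disk_area fineK; last exact: plane_area_open_disk1_fin.
apply: (@lt_le_trans _ _ (plane_area (`[0:R, 2^-1]%classic `*` `[0:R, 2^-1]%classic))).
  by rewrite plane_area_rectangle ?invr_gt0// lte_fin subr0 mulr_gt0 ?invr_gt0.
apply: le_plane_area; [exact: measurableX|exact: measurable_open_disk|].
move=> z [/=]; rewrite !in_itv/= => /andP[x0 x1] /andP[y0 y1].
rewrite /open_disk/= /beacon_distance -[ltRHS]sqrtr1 ltr_sqrt//.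
have : z.1 ^+ 2 <= 2^-1 ^+ 2 by rewrite ler_sqr ?nnegrE ?invr_ge0.
have : z.2 ^+ 2 <= 2^-1 ^+ 2 by rewrite ler_sqr ?nnegrE ?invr_ge0.
lra.
Qed.

Lemma plane_area_open_disk (R : realType) (r : R) : 0 < r ->
  plane_area (open_disk r) = (unit_disk_area R * r ^+ 2)%:E.
Proof.
move=> r0; rewrite plane_area_open_disk1// [in RHS]EFinM muleC /unit_disk_area.
by rewrite (fineK (plane_area_open_disk1_fin R)).
Qed.

(* The unit circle is a null set, because s^2 times the area of the closed unit
   disk is at most kappa for every s < 1. *)
Lemma plane_area_closed_disk (R : realType) (r : R) : 0 < r ->
  plane_area (closed_disk r) = (unit_disk_area R * r ^+ 2)%:E.
Proof.
move=> r0; rewrite plane_area_closed_disk1// [in RHS]EFinM muleC; congr (_ * _)%E.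
have cfin := @plane_area_closed_disk1_fin R.
rewrite -(fineK cfin); congr EFin; apply/eqP; rewrite eq_le; apply/andP; split; last first.
  rewrite -lee_fin /unit_disk_area (fineK cfin) (fineK (plane_area_open_disk1_fin R)).
  apply: le_plane_area; [exact: measurable_open_disk|exact: measurable_closed_disk|].
  by move=> z /ltW.
set k1 := fine _; rewrite leNgt; apply/negP => k01.
have k0 := @unit_disk_area_gt0 R.
set k := unit_disk_area R in k0 k01.
have k10 : 0 < k1 by rewrite (lt_trans k0).
(* If k < k1, this is the midpoint of k / k1 and 1. With s^2 = u, the closed disk of radius s < 1
   has area u k1 = (k + k1) / 2 > k, although it lies in the open unit disk. *)
pose u := (k + k1) / (2 * k1).
have u0 : 0 < u by rewrite divr_gt0 ?addr_gt0 ?mulr_gt0.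
pose s := Num.sqrt u.
have s0 : 0 < s by rewrite sqrtr_gt0.
have s1 : s < 1.
  rewrite -[ltRHS]sqrtr1 ltr_sqrt// /u ltr_pdivrMr ?mulr_gt0//; lra.
have : (plane_area (closed_disk s) <= plane_area (open_disk (1 : R)))%E.
  apply: le_plane_area; [exact: measurable_closed_disk|exact: measurable_open_disk|].
  by move=> z /= /le_lt_trans; exact.
rewrite plane_area_closed_disk1// plane_area_open_disk// -(fineK cfin) -EFinM lee_fin.
rewrite -/k -/k1 expr1n mulr1 sqr_sqrtr ?(ltW u0)// /u invfM mulrA mulfVK ?gt_eqF//.
lra.
Qed.

(** This is the part of the annulus cut out by D < r; the case [rin = r] gives the end of the tail
    function. *)
Lemma plane_area_annulus_co (R : realType) (rin r : R) : 0 < rin -> rin <= r ->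
  plane_area (open_disk r `\` open_disk rin)
  = (unit_disk_area R * (r ^+ 2 - rin ^+ 2))%:E.
Proof.
move=> rin0 rinr; have r0 : 0 < r by rewrite (lt_le_trans rin0).
rewrite /plane_area measureD//=.
- rewrite setIidr; last by move=> z /lt_le_trans; exact.
  rewrite -!/(plane_area _) !plane_area_open_disk// -EFinB -mulrBr//.
- exact: measurable_open_disk.
- exact: measurable_open_disk.
- by rewrite -/(plane_area _) plane_area_open_disk// ltry.
Qed.

Lemma plane_area_annulus (R : realType) (rin r : R) : 0 < rin -> rin <= r ->
  plane_area (annulus rin r) = (unit_disk_area R * (r ^+ 2 - rin ^+ 2))%:E.
Proof.
move=> rin0 rinr; have r0 : 0 < r by rewrite (lt_le_trans rin0).
have -> : annulus rin r = closed_disk r `\` open_disk rin.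
  apply/seteqP; split => z; rewrite /annulus/closed_disk/open_disk/=.
    by move=> /andP[? ?]; split => //; apply/negP; rewrite -leNgt.
  by move=> [-> /negP]; rewrite -leNgt => ->.
rewrite /plane_area measureD//=.
- rewrite setIidr; last by move=> z /lt_le_trans /(_ rinr) /ltW.
  rewrite -!/(plane_area _) plane_area_closed_disk// plane_area_open_disk//.
  by rewrite -EFinB -mulrBr.
- exact: measurable_closed_disk.
- exact: measurable_open_disk.
- by rewrite -/(plane_area _) plane_area_closed_disk// ltry.
Qed.

(** * Independence and the exponential gain *)

Section independence.
Context d (T : measurableType d) (R : realType) (P : probability T R).

Lemma independent_rv_comp (X Y : T -> R) (f : R -> R) :
  measurable_fun setT f -> independent_rv P X Y ->
  independent_rv P (f \o X) Y.
Proof.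
move=> mf XY A B mA mB; rewrite comp_preimage; apply: XY => //.
by rewrite -[X in measurable X]setTI; exact: mf.
Qed.

(** Makes a fixed distance a special case of a random distance independent of the gain. *)
Lemma independent_rv_cst (c : R) (Y : {RV P >-> R}) :
  independent_rv P (cst c) Y.
Proof.
move=> A B mA mB; rewrite preimage_cst; case: ifPn => _.
  by rewrite setTI probability_setT mul1e.
by rewrite set0I measure0 mul0e.
Qed.

Local Open Scope ereal_scope.

(* The joint law of independent variables is the product of their laws, so
   that Tonelli's theorem applies. *)
Lemma ge0_integral_mul_independent (X Y : {RV P >-> R}) :
  independent_rv P X Y -> (forall t, 0 <= X t)%R -> (forall t, 0 <= Y t)%R ->
  \int[P]_t (X t * Y t)%:E = \int[P]_t (X t)%:E * \int[P]_t (Y t)%:E.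
Proof.
move=> XY X0 Y0.
have mXY : measurable_fun setT (fun t => (X t, Y t)).
  by apply/measurable_fun_pairP; split.
pose Z := @mfun_Sub _ _ T (R * R)%type _ (mem_set mXY) : {RV P >-> (R * R)%type}.
have jointE : forall B, measurable B ->
    (distribution P X \x distribution P Y) B = distribution P Z B.
  exact: product_measure_unique.
(* Tonelli needs an integrand that is nonnegative on the whole plane, so the identity is truncated
   at 0; on the values of [X] and [Y] nothing changes. *)
pose f (x : R) : \bar R := (Num.max x 0)%:E.
have mf : measurable_fun setT f.
  by apply/measurable_EFinP; exact: measurable_maxr.
have f0 x : 0 <= f x by rewrite lee_fin le_max lexx orbT.
have fE x : (0 <= x)%R -> f x = x%:E by move=> x0; rewrite /f max_l.
pose g (z : R * R) := f z.1 * f z.2.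
have mg : measurable_fun setT g.
  by apply: emeasurable_funM; apply: measurableT_comp.
have g0 z : 0 <= g z by exact: mule_ge0.
transitivity (\int[P]_t (g \o Z) t).
  by apply: eq_integral => t _; rewrite /g/= !fE// EFinM.
rewrite -ge0_integral_distribution//.
transitivity (\int[distribution P X \x distribution P Y]_z g z).
  by apply: eq_measure_integral => A mA _; exact/esym/jointE.
rewrite fubini_tonelli1//.
under eq_integral => x _.
  rewrite /fubini_F /g/= ge0_integralZl//.
  over.
rewrite ge0_integralZr//; last by apply: integral_ge0.
by rewrite !ge0_integral_distribution//; congr (_ * _);
  apply: eq_integral => t _ /=; rewrite fE.
Qed.

End independence.

Section exponential_mean.
Context (R : realType).
Local Open Scope ereal_scope.

(** On the nonnegative half-line the density has antiderivative -exp(-r x), which vanishes at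
    infinity. *)
Lemma exponential_prob_itvoy (r t : R) : (0 < r)%R -> (0 <= t)%R ->
  exponential_prob r `]t, +oo[ = (expR (- r * t))%:E.
Proof.
move=> r0 t0; rewrite /exponential_prob.
have mE : measurable_fun setT (exponential_pdf r) by exact: measurable_exponential_pdf.
have cexp : continuous (fun x : R => - expR (- r * x))%R.
  move=> x; apply: cvgN; apply: continuous_comp; last exact: continuous_expR.
  exact: mulrl_continuous.
rewrite integral_itv_obnd_cbnd; last first.
  by apply/measurable_EFinP; exact: measurable_funTS.
rewrite (@ge0_continuous_FTC2y _ _ (fun x => - (expR (- r * x)))%R _ 0%R)//.
- by rewrite add0e -EFinN opprK.
- by move=> x _; apply: exponential_pdf_ge0; exact: ltW.
- apply: continuous_subspaceW (@within_continuous_exponential_pdf R r).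
  by apply: subset_itvr; rewrite bnd_simp.
- rewrite -oppr0; apply: cvgN.
  rewrite (_ : (fun x => expR (- r * x)) =
               (fun z => expR (- z)) \o (fun z => r * z))%R; last first.
    by apply: eq_fun => x; rewrite mulNr.
  apply: (@cvg_comp _ _ _ _ _ _ (pinfty_nbhs R)); last exact: cvgr_expR.
  exact: gt0_cvgMry.
- by apply/cvg_at_right_filter; exact: cexp.
- move=> x; rewrite in_itv/= andbT => tx.
  by apply: derive1_exponential_pdf; rewrite in_itv/= andbT (le_lt_trans t0).
Qed.

(** Up to the factor [r], the integrand is the exponential density, whose total mass is 1 and which
    is 0 off [[0, +oo[]. *)
Lemma integral_expRN (r : R) : (0 < r)%R ->
  \int[lebesgue_measure]_(t in `[0%R, +oo[) (expR (- r * t))%:E = (r^-1)%:E.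
Proof.
move=> r0; have : exponential_prob r setT = 1.
  exact: integral_exponential_pdf.
rewrite /exponential_prob => H.
have mexp : measurable_fun setT (fun x : R => expR (- r * x)).
  by apply: measurableT_comp => //; exact: measurable_funM.
transitivity ((r^-1)%:E * \int[lebesgue_measure]_(t in `[0%R, +oo[) (r * expR (- r * t))%:E).
  rewrite -ge0_integralZl//; last 3 first.
  - by apply/measurable_EFinP/measurable_funTS; exact: measurable_funM.
  - by move=> x _; rewrite lee_fin mulr_ge0 ?expR_ge0 ?ltW.
  - by rewrite lee_fin invr_ge0 ltW.
  by apply: eq_integral => x _; rewrite -EFinM mulrA mulVf ?mul1r ?gt_eqF.
rewrite [X in _ * X](_ : _ = 1) ?mule1//.
rewrite -[RHS]H integral_mkcond; apply: eq_integral => x _.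
by rewrite /exponential_pdf !patchE; case: ifP.
Qed.

End exponential_mean.

Section exponential_gain.
Context d (T : measurableType d) (R : realType) (P : probability T R).
Variables (G : {RV P >-> R}) (m : R).
Hypotheses (m0 : 0 < m) (Gexp : exponential_with_mean G m).
Local Open Scope ereal_scope.

(** The law of [G] makes it nonnegative only almost everywhere; its positive part is nonnegative
    everywhere, as the tail formula for the mean and Tonelli require. *)
Let Gp : {RV P >-> R} := G^\+%R.

Lemma exponential_gain_ae_ge0 : {ae P, forall t, Gp t = G t}.
Proof.
exists (G @^-1` `]-oo, 0%R[); split.
- by rewrite -[X in measurable X]setTI; exact: measurable_funP.
- rewrite [LHS](Gexp _)//; apply: integral0_eq => x /=; rewrite in_itv/= => x0.
  by rewrite lt0_exponential_pdf.
- move=> t /=; rewrite in_itv/= => h; rewrite ltNge; apply/negP => G0; apply: h.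
  by rewrite /Gp/= /funrpos max_l.
Qed.

(** The mean is the integral of the tail, which is exp(-t / m): for t >= 0 the events Gp > t and G >
    t coincide. *)
Lemma integral_exponential_gain : \int[P]_t (Gp t)%:E = m%:E.
Proof.
rewrite -expectation_def ge0_expectation_ccdf; last by move=> x; exact: funrpos_ge0.
transitivity (\int[lebesgue_measure]_(t in `[0%R, +oo[) (expR (- m^-1 * t))%:E).
  apply: eq_integral => t; rewrite inE/= in_itv/= andbT => t0.
  rewrite -exponential_prob_itvoy ?invr_gt0// -Gexp//.
  rewrite /ccdf /distribution /pushforward; congr (P _).
  apply/seteqP; split => x; rewrite /= !in_itv/= !andbT /Gp/= /funrpos lt_max => h.
    by case/orP : h => //; rewrite ltNge t0.
  by rewrite h.
by rewrite integral_expRN ?invr_gt0// invrK.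
Qed.

(** Replacing [G] by its positive part changes the product only on a null set and preserves
    independence, so the nonnegative case applies. *)
Lemma expectation_mul_exponential (X : {RV P >-> R}) :
  (forall t, 0 <= X t)%R -> independent_rv P X G ->
  'E_P[fun t => X t * G t]%R = 'E_P[X] * m%:E.
Proof.
move=> X0 XG; rewrite unlock.
transitivity (\int[P]_t (X t * Gp t)%:E).
  apply: ae_eq_integral => //.
  - by apply/measurable_EFinP; exact: measurable_funM.
  - by apply/measurable_EFinP; exact: measurable_funM.
  - apply: filterS exponential_gain_ae_ge0 => t /= GpE _.
    by rewrite GpE.
have XGp : independent_rv P X Gp.
  move=> A B mA mB; rewrite (_ : Gp @^-1` B = G @^-1` ((Num.max ^~ 0%R) @^-1` B))//.
  apply: XG => //; rewrite -[X in measurable X]setTI.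
  exact: measurable_maxr.
rewrite ge0_integral_mul_independent//; last by move=> t; exact: funrpos_ge0.
by rewrite integral_exponential_gain.
Qed.

End exponential_gain.

(** * Mean path loss *)

Lemma ltr_powRN (R : realType) (a x y : R) : 0 < a -> 0 < x -> 0 < y ->
  (x `^ (- a) < y `^ (- a)) = (y < x).
Proof.
move=> a0 x0 y0; rewrite !powRN ltf_pV2 ?posrE ?powR_gt0//.
apply/idP/idP => [|yx]; last by rewrite gt0_ltr_powR ?nnegrE ?ltW.
apply: contraTT; rewrite -!leNgt => xy.
by apply: ge0_ler_powR => //; rewrite ?nnegrE ltW.
Qed.

Lemma powR_invK (R : realType) (a t : R) : a != 0 -> 0 <= t ->
  (t `^ (a^-1)) `^ a = t.
Proof. by move=> a0 t0; rewrite -powRrM mulVf// powRr1. Qed.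

(** The antiderivative [F] is a parameter because it will be a power when alpha > 2 and the
    logarithm when alpha = 2. *)
Lemma integral_affine_FTC2 (R : realType) (a b s c : R) (f F : R -> R) :
  0 < a -> a < b -> (forall x : R, 0 < x -> is_derive x 1 F (f x)) ->
  (forall x : R, 0 < x -> derivable f x 1) ->
  (\int[lebesgue_measure]_(x in `[a, b]) (c * (f x - s))%:E
    = (c * ((F b - F a) - s * (b - a)))%:E)%E.
Proof.
move=> a0 ab dF df.
have dG (x : R) : 0 < x -> is_derive x 1 (fun x => c * (F x - s * x)) (c * (f x - s)).
  move=> x0; have dFx := dF _ x0.
  by apply: is_derive_eq; rewrite /GRing.scale/= mulr1.
rewrite (@continuous_FTC2 _ _ (fun x => c * (F x - s * x)))//.
- by rewrite -EFinB; congr EFin; ring.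
- apply: derivable_within_continuous => x; rewrite in_itv/= => /andP[ax _].
  have x0 : 0 < x by rewrite (lt_le_trans a0).
  by apply: derivableM => //; apply: derivableB => //; exact: df.
- have dG1 (x : R) : 0 < x -> derivable (fun x => c * (F x - s * x)) x 1.
    by move=> /dG [].
  have cG (x : R) : 0 < x -> {for x, continuous (fun x => c * (F x - s * x))}.
    by move=> x0; apply/differentiable_continuous/derivable1_diffP/dG1.
  split.
  + by move=> x; rewrite in_itv/= => /andP[ax _]; apply: dG1; rewrite (lt_trans a0).
  + by apply: cvg_at_right_filter; exact: cG.
  + by apply: cvg_at_left_filter; apply: cG; rewrite (lt_trans a0).
- move=> x; rewrite in_itv/= => /andP[ax _]; rewrite derive1E.
  by have [_ ->] := dG x (lt_trans a0 ax).
Qed.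

Section path_loss.
Context d (T : measurableType d) (R : realType) (P : probability T R).
Variables (Z : {RV P >-> (R * R)%type}) (alpha rex rnet : R).
Hypotheses (alpha0 : 0 < alpha) (rex0 : 0 < rex) (rexnet : rex < rnet).
Hypothesis Zunif : uniform_in Z (annulus rex rnet).

Let rnet0 : 0 < rnet. Proof. exact: lt_trans rexnet. Qed.

Let gap_gt0 : 0 < rnet ^+ 2 - rex ^+ 2.
Proof. by rewrite subr_gt0 ltr_sqr ?nnegrE ?ltW. Qed.

Lemma measurable_distance : measurable_fun setT (@beacon_distance R \o Z).
Proof. by apply: measurableT_comp => //; exact: measurable_beacon_distance. Qed.

Lemma measurable_path_loss :
  measurable_fun setT (fun w => (@beacon_distance R \o Z) w `^ (- alpha)).
Proof. exact: (measurableT_comp (@measurable_powR R _) measurable_distance). Qed.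

Definition path_loss : {RV P >-> R} := mfun_Sub (mem_set measurable_path_loss).

(** Evaluating the tail at r^(-alpha) turns its event into D < r, a half-open annulus within the
    support; kappa cancels in the ratio of areas. *)
Lemma ccdf_path_loss (r : R) : rex <= r <= rnet ->
  ccdf path_loss (r `^ (- alpha))
  = ((rnet ^+ 2 - rex ^+ 2)^-1 * (r ^+ 2 - rex ^+ 2))%:E.
Proof.
move=> /andP[rexr rrnet]; have r0 : 0 < r by rewrite (lt_le_trans rex0).
pose B : set (R * R) :=
  (fun z => beacon_distance z `^ (- alpha)) @^-1` `]r `^ (- alpha), +oo[.
have mB : measurable B.
  rewrite -[X in measurable X]setTI.
  suff : measurable_fun setT (fun z : R * R => beacon_distance z `^ (- alpha)) by exact.
  exact: (measurableT_comp (@measurable_powR R _) (@measurable_beacon_distance R)).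
transitivity (distribution P Z B); first by [].
have BE : B `&` annulus rex rnet = open_disk r `\` open_disk rex.
  apply/seteqP; split => z; rewrite /B /annulus /open_disk /= in_itv/= andbT.
    move=> [h /andP[zex _]].
    have z0 : 0 < beacon_distance z by rewrite (lt_le_trans rex0).
    by rewrite ltr_powRN// in h; split => //; apply/negP; rewrite -leNgt.
  move=> [zr /negP]; rewrite -leNgt => zex.
  have z0 : 0 < beacon_distance z by rewrite (lt_le_trans rex0).
  by rewrite ltr_powRN// zex (le_trans (ltW zr)).
rewrite Zunif// BE plane_area_annulus_co// plane_area_annulus ?ltW//=.
congr EFin; rewrite invfM.
have := @unit_disk_area_gt0 R; set k := unit_disk_area R => k0.
by field; rewrite !gt_eqF.
Qed.

(** The tail is already 1 at rnet^(-alpha), and it is nonincreasing. *)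
Lemma ccdf_path_loss_lt (t : R) : t < rnet `^ (- alpha) -> ccdf path_loss t = 1%E.
Proof.
move=> ht; apply/eqP; rewrite eq_le; apply/andP; split.
  exact: probability_le1.
have <- : ccdf path_loss (rnet `^ (- alpha)) = 1%E.
  by rewrite ccdf_path_loss ?lexx ?ltW// mulVf ?gt_eqF.
by apply: ccdf_nonincreasing; exact: ltW.
Qed.

Lemma ccdf_path_loss_gt (t : R) : rex `^ (- alpha) < t -> ccdf path_loss t = 0%E.
Proof.
move=> ht; apply/eqP; rewrite eq_le; apply/andP; split; last exact: measure_ge0.
have <- : ccdf path_loss (rex `^ (- alpha)) = 0%E.
  by rewrite ccdf_path_loss ?lexx ?ltW// subrr mulr0.
by apply: ccdf_nonincreasing; exact: ltW.
Qed.

(** Substitute r = t^(-1/alpha), so that r^2 = t^(-2/alpha). *)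
Lemma ccdf_path_loss_mid (t : R) : rnet `^ (- alpha) <= t <= rex `^ (- alpha) ->
  ccdf path_loss t
  = ((rnet ^+ 2 - rex ^+ 2)^-1 * (t `^ (- (2 / alpha)) - rex ^+ 2))%:E.
Proof.
move=> /andP[tnet tex].
have t0 : 0 < t by rewrite (lt_le_trans _ tnet)// powR_gt0.
pose r := t `^ ((- alpha)^-1).
have r0 : 0 < r by rewrite powR_gt0.
have tE : t = r `^ (- alpha).
  by rewrite powR_invK ?oppr_eq0 ?gt_eqF// ltW.
rewrite [in LHS]tE ccdf_path_loss; last first.
  rewrite tE leNgt ltr_powRN// -leNgt in tnet.
  by rewrite tE leNgt ltr_powRN// -leNgt in tex; rewrite tex tnet.
congr (_ * (_ - _))%:E.
rewrite tE -powRrM mulrNN mulrCA divff ?gt_eqF// mulr1.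
by rewrite -powR_mulrn// ltW.
Qed.

(** The mean is the integral of the tail, split at [a] and [b]: the tail is 1 before [a], which
    contributes [a]; it is affine in t^(-2/alpha) between them; it is 0 beyond [b]. *)
Lemma expectation_path_loss (F : R -> R) :
  (forall x : R, 0 < x -> is_derive x 1 F (x `^ (- (2 / alpha)))) ->
  let a := rnet `^ (- alpha) in let b := rex `^ (- alpha) in
  'E_P[path_loss]%E = (a + (rnet ^+ 2 - rex ^+ 2)^-1
                         * ((F b - F a) - rex ^+ 2 * (b - a)))%:E.
Proof.
move=> dF a b.
have a0 : 0 < a by exact: powR_gt0.
have ab : a < b by rewrite ltr_powRN.
rewrite ge0_expectation_ccdf; last by move=> x; exact: powR_ge0.
have mc (D : set R) : measurable_fun D (ccdf path_loss).
  by apply: measurable_funTS; exact: ccdf_measurable.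
rewrite (@itv_bndbnd_setU _ _ _ (BLeft a)) ?bnd_simp ?ltW//.
rewrite ge0_integral_setU//=; [|exact: mc|]; last first.
  rewrite disj_set2E; apply/eqP; rewrite -subset0 => x [/=].
  by rewrite !in_itv/= => /andP[_ xa] /andP[/(lt_le_trans xa)]; rewrite ltxx.
rewrite (@itv_bndbnd_setU _ _ (BLeft a) (BRight b)) ?bnd_simp ?ltW//.
rewrite ge0_integral_setU//=; [|exact: mc|]; last first.
  rewrite disj_set2E; apply/eqP; rewrite -subset0 => x [/=].
  by rewrite !in_itv/= => /andP[_ xb] /andP[/lt_le_trans /(_ xb)]; rewrite ltxx.
rewrite [X in (_ + (_ + X))%E]integral0_eq; last first.
  by move=> x; rewrite /= in_itv/= andbT => bx; exact: ccdf_path_loss_gt.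
have I1 : (\int[lebesgue_measure]_(x in `[0%R, a[) ccdf path_loss x = a%:E)%E.
  transitivity (\int[lebesgue_measure]_(x in `[0%R, a[) (cst 1%E x))%E.
    apply: eq_integral => x; rewrite inE/= in_itv/= => /andP[_ xa].
    exact: ccdf_path_loss_lt.
  rewrite integral_cst//= mul1e lebesgue_measure_itv/= lte_fin a0.
  by rewrite oppr0 adde0.
have I2 : (\int[lebesgue_measure]_(x in `[a, b]) ccdf path_loss x
    = ((rnet ^+ 2 - rex ^+ 2)^-1 * ((F b - F a) - rex ^+ 2 * (b - a)))%:E)%E.
  transitivity (\int[lebesgue_measure]_(x in `[a, b])
      ((rnet ^+ 2 - rex ^+ 2)^-1 * (x `^ (- (2 / alpha)) - rex ^+ 2))%:E)%E.
    apply: eq_integral => x; rewrite inE/= in_itv/= => xab.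
    exact: ccdf_path_loss_mid.
  apply: integral_affine_FTC2 => // x x0.
  by apply: derivable_powR; rewrite in_itv/= x0.
by rewrite [X in (_ + X)%E]adde0 I1 I2 -EFinD.
Qed.

Lemma expectation_path_loss_gt2 : 2 < alpha ->
  'E_P[path_loss]%E = (2 / ((alpha - 2) * (rnet ^+ 2 - rex ^+ 2))
    * (rex `^ (2 - alpha) - rnet `^ (2 - alpha)))%:E.
Proof.
move=> alpha2.
(* The exponent of the antiderivative of x^(-2/alpha), nonzero since alpha differs from 2. *)
pose g := 1 - 2 / alpha.
have g0 : g != 0 by rewrite subr_eq0 eq_sym; apply/eqP => /divr1_eq h; rewrite h ltxx in alpha2.
have dF (x : R) : 0 < x ->
    is_derive x 1 (fun x => g^-1 * x `^ g) (x `^ (- (2 / alpha))).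
  move=> x0.
  have x0' : x \in `]0, +oo[ by rewrite in_itv/= x0.
  have dp : is_derive x 1 (@powR R ^~ g) (g * x `^ (g - 1)).
    by apply: DeriveDef; [exact: derivable_powR|rewrite -derive1E powR_derive1].
  apply: is_derive_eq; rewrite /GRing.scale/= mulrA mulVf// mul1r.
  by congr (_ `^ _); rewrite /g; ring.
rewrite (expectation_path_loss dF); congr EFin.
(* Every real power is reduced to x^(-alpha) times a square; once the two values of x^(-alpha) are
   abstracted, a rational identity remains. *)
have powE (x : R) : 0 < x -> (x `^ (- alpha)) `^ g = x ^+ 2 * x `^ (- alpha).
  move=> x0; have xn0 : x != 0 by rewrite gt_eqF.
  rewrite -powRrM -powR_mulrn ?ltW// -powRD ?xn0 ?implybT//.
  by congr (_ `^ _); rewrite /g; field; rewrite gt_eqF.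
have powE2 (x : R) : 0 < x -> x `^ (2 - alpha) = x ^+ 2 * x `^ (- alpha).
  move=> x0; have xn0 : x != 0 by rewrite gt_eqF.
  by rewrite powRD ?xn0 ?implybT// powR_mulrn// ltW.
rewrite !powE// !powE2// /g.
have D0 := gap_gt0.
move: (rex `^ _) (rnet `^ _) => A B.
field.
by rewrite (gt_eqF D0) (gt_eqF alpha0) subr_eq0 (gt_eqF alpha2).
Qed.

(** Now t^(-2/alpha) is 1/t, with antiderivative [ln]. The other terms cancel: rex^2 (rex^(-2) -
    rnet^(-2)) / (rnet^2 - rex^2) is rnet^(-2), the contribution of the first interval. *)
Lemma expectation_path_loss_2 : alpha = 2 ->
  'E_P[path_loss]%E = (2 / (rnet ^+ 2 - rex ^+ 2) * (ln rnet - ln rex))%:E.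
Proof.
move=> alpha2.
have dF (x : R) : 0 < x -> is_derive x 1 (@ln R) (x `^ (- (2 / alpha))).
  move=> x0; rewrite alpha2 divff// powR_inv1 ?ltW//.
  exact: is_derive1_ln.
rewrite (expectation_path_loss dF); congr EFin; rewrite !ln_powR alpha2.
rewrite !powR_invn ?ltW//.
have D0 := gap_gt0.
field.
by rewrite !gt_eqF.
Qed.

End path_loss.

(** * Average output power *)

Lemma ge0_expectationZl d (T : measurableType d) (R : realType)
    (P : probability T R) (k : R) (X : {RV P >-> R}) :
  0 <= k -> (forall t, 0 <= X t) ->
  ('E_P[fun t => (k * X t)%R] = k%:E * 'E_P[X])%E.
Proof.
move=> k0 X0; rewrite unlock.
under eq_integral do rewrite EFinM.
rewrite ge0_integralZl//; first exact/measurable_EFinP.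
by move=> t _; rewrite lee_fin.
Qed.

Section average.
Context d (T : measurableType d) (R : realType) (P : probability T R).
Variables (Z : {RV P >-> (R * R)%type}) (G : {RV P >-> R}).
Variables (c beta sigma2 rex rnet alpha : R).
Hypotheses (c0 : 0 < c) (beta0 : 0 < beta) (sigma20 : 0 < sigma2).

(** The distance is kept general so that users in the annulus and symmetric users share one
    computation. *)
Lemma rrs_average_independent (D : T -> R) :
  measurable_fun setT D -> exponential_with_mean G sigma2 ->
  independent_rv P D G ->
  rrs_average P (output_power c beta alpha D G)
  = ((c * beta)%:E * 'E_P[fun w => (D w `^ (- alpha))%R] * sigma2%:E)%E.
Proof.
move=> mD Gexp DG.
have cb0 : 0 <= c * beta by rewrite mulr_ge0// ltW.
have mL : measurable_fun setT (fun w => D w `^ (- alpha)).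
  exact: (measurableT_comp (@measurable_powR R _) mD).
pose L : {RV P >-> R} := mfun_Sub (mem_set mL).
have mX : measurable_fun setT (fun w => c * beta * L w).
  exact: measurable_funM.
pose X : {RV P >-> R} := mfun_Sub (mem_set mX).
have X0 w : 0 <= X w by rewrite mulr_ge0// powR_ge0.
have XG : independent_rv P X G.
  apply: (independent_rv_comp (f := fun x => c * beta * x `^ (- alpha))) DG.
  by apply: measurable_funM => //; exact: measurable_powR.
rewrite /rrs_average -(ge0_expectationZl (X := L))//; last first.
  by move=> t; exact: powR_ge0.
exact: (expectation_mul_exponential sigma20 Gexp X0 XG).
Qed.

Lemma rrs_average_het : annulus_user Z G sigma2 rex rnet ->
  rrs_average P (output_power c beta alpha (@beacon_distance R \o Z) G)
  = ((c * beta * sigma2)%:E * 'E_P[path_loss Z alpha])%E.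
Proof.
move=> [_ Gexp DG].
rewrite rrs_average_independent//; last exact: measurable_distance.
by rewrite muleAC -EFinM.
Qed.

Lemma rrs_average_sym (dist : R) : exponential_with_mean G sigma2 ->
  rrs_average P (output_power c beta alpha (cst dist) G)
  = (c * beta * sigma2 * dist `^ (- alpha))%:E.
Proof.
move=> Gexp; rewrite rrs_average_independent//; last exact: independent_rv_cst.
by rewrite (expectation_cst P (dist `^ (- alpha))) muleAC -!EFinM.
Qed.

End average.

(** * Limit of the exact formula at path-loss exponent 2 *)

Lemma is_derive_powRr (R : realType) (x a : R) : 0 < x ->
  is_derive a (1 : R) (fun t => x `^ (2 - t)) (- ln x * x `^ (2 - a)).
Proof.
move=> x0.
rewrite (_ : (fun t => x `^ (2 - t)) = expR \o (fun t => (2 - t) * ln x)); last first.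
  by apply/funext => t; rewrite /powR gt_eqF.
apply: is_derive_eq.
rewrite /powR gt_eqF// /GRing.scale/=.
by ring.
Qed.

(** Up to a constant factor the formula is h(a) / (a - 2) with h(2) = 0, a difference quotient whose
    limit is h'(2) = ln rnet - ln rex. *)
Lemma cvg_het_formula (R : realType) (c beta sigma2 rex rnet : R) :
  0 < rex -> rex < rnet ->
  het_formula c beta sigma2 rex rnet a @[a --> (2 : R)^'] -->
  c * beta * sigma2 * (2 / (rnet ^+ 2 - rex ^+ 2) * (ln rnet - ln rex)).
Proof.
move=> rex0 rexnet; have rnet0 := lt_trans rex0 rexnet.
pose h (t : R) : R := rex `^ (2 - t) - rnet `^ (2 - t).
have dh : is_derive (2 : R) (1 : R) h (ln rnet - ln rex).
  have d1 := is_derive_powRr 2 rex0.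
  have d2 := is_derive_powRr 2 rnet0.
  by apply: is_derive_eq; rewrite subrr !powRr0 !mulr1 opprK addrC.
have h2 : h 2 = 0 by rewrite /h subrr !powRr0 subrr.
have [dv /esym de] := dh.
have q : (t^-1 *: (h (t *: 1 + 2) - h 2)) @[t --> 0^'] --> ln rnet - ln rex.
  by rewrite de; exact: dv.
(* Sequences avoiding 2 make the change of variable easy: the increment t of the quotient is taken
   to be [u n - 2]. *)
apply/cvgr_dnbhsP => u [u2 ucvg].
have {}q : ((u n - 2)^-1 * h (u n)) @[n --> \oo] --> ln rnet - ln rex.
  have v0 : (forall n, u n - 2 != 0) /\ (u n - 2 @[n --> \oo] --> 0).
    split; first by move=> n; rewrite subr_eq0.
    by rewrite -(subrr 2); apply: cvgB => //; exact: cvg_cst.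
  move/cvgr_dnbhsP : q => /(_ _ v0).
  by under eq_cvg do rewrite /= h2 subr0 /GRing.scale/= mulr1 subrK.
rewrite (_ : (fun n => _) = (fun n => c * beta * sigma2 * (2 / (rnet ^+ 2 - rex ^+ 2)) *
    ((u n - 2)^-1 * h (u n)))); last first.
  apply/funext => n; rewrite /het_formula -/(h _) invfM; ring.
by rewrite [X in _ --> X]mulrA; apply: cvgM => //; exact: cvg_cst.
Qed.

(** * Equivalent distance and relative error of the approximation *)

Section approximation.
Context (R : realType).
Implicit Types c beta rex rnet alpha eps : R.

Lemma het_approx_gt0 c beta (sigma2 : R) rex rnet alpha :
  0 < c -> 0 < beta -> 0 < sigma2 -> 0 < rex -> 0 < rnet -> 2 < alpha ->
  0 < het_approx c beta sigma2 rex rnet alpha.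
Proof.
move=> c0 b0 s0 rex0 rnet0 a2; rewrite /het_approx /power_scaling.
by rewrite !mulr_gt0 ?powR_gt0 ?exprn_gt0 ?invr_gt0 ?divr_gt0 ?subr_gt0.
Qed.

Lemma distance_scaling_gt0 alpha rex rnet :
  0 < rex -> 0 < rnet -> 2 < alpha -> 0 < distance_scaling alpha rex rnet.
Proof.
move=> rex0 rnet0 a2; apply: powR_gt0.
by rewrite mulr_gt0 ?divr_gt0 ?exprn_gt0 ?divr_gt0 ?subr_gt0.
Qed.

(** The bracket u inside the distance scaling is the inverse of the power scaling, and
    (u^(1/alpha))^(-alpha) = 1/u. *)
Lemma het_approx_distance c beta (sigma2 : R) rex rnet alpha :
  0 < rex -> 0 < rnet -> 2 < alpha ->
  het_approx c beta sigma2 rex rnet alpha =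
  c * beta * sigma2 * (rex * distance_scaling alpha rex rnet) `^ (- alpha).
Proof.
move=> rex0 rnet0 a2; have a0 : 0 < alpha by rewrite (lt_trans _ a2).
rewrite /het_approx powRM ?(ltW rex0)//; last first.
  by rewrite ltW// distance_scaling_gt0.
rewrite -!mulrA; congr (_ * (_ * (_ * (_ * _)))).
set u := (alpha - 2) / 2 * (rnet / rex) ^+ 2.
have u0 : 0 < u.
  by rewrite mulr_gt0 ?divr_gt0 ?exprn_gt0 ?divr_gt0 ?subr_gt0.
rewrite /distance_scaling -/u -powRrM mulrN mulVf ?gt_eqF// powR_inv1 ?ltW//.
rewrite /power_scaling /u; field.
by rewrite !gt_eqF ?subr_gt0.
Qed.

(** The ratio is written in rex / rnet so that both corrections are positive powers of a number that
    becomes small. *)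
Lemma het_formula_approx c beta (sigma2 : R) rex rnet alpha :
  0 < rex -> rex < rnet -> 2 < alpha ->
  het_formula c beta sigma2 rex rnet alpha =
  het_approx c beta sigma2 rex rnet alpha
  * ((1 - (rex / rnet) `^ (alpha - 2)) / (1 - (rex / rnet) ^+ 2)).
Proof.
move=> rex0 rexnet a2; have rnet0 := lt_trans rex0 rexnet.
have gap : 0 < rnet ^+ 2 - rex ^+ 2 by rewrite subr_gt0 ltr_sqr ?nnegrE ?ltW.
have powE (x : R) : 0 < x -> x `^ (2 - alpha) = x ^+ 2 * x `^ (- alpha).
  move=> x0; have xn0 : x != 0 by rewrite gt_eqF.
  by rewrite powRD ?xn0 ?implybT// powR_mulrn// ltW.
have -> : (rex / rnet) `^ (alpha - 2) =
    (rnet ^+ 2 * rnet `^ (- alpha)) / (rex ^+ 2 * rex `^ (- alpha)).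
  rewrite -!powE// powRM ?invr_ge0 ?ltW// -(opprB 2 alpha) powRN mulrC.
  congr (_ * _); by rewrite -[rnet^-1]powR_inv1 ?ltW// -powRrM mulrNN mul1r.
rewrite /het_formula /het_approx /power_scaling !powE//.
have := powR_gt0 (- alpha) rex0; have := powR_gt0 (- alpha) rnet0.
move: (rex `^ _) (rnet `^ _) => A B B0 A0.
field.
by rewrite !(gt_eqF gap, gt_eqF rex0, gt_eqF rnet0, gt_eqF A0) subr_eq0 (gt_eqF a2).
Qed.

(** With x = rex / rnet, q = x^2 and w = x^(alpha - 2), the relative error is |q - w| / (1 - q). The
    threshold depends on [alpha] and [eps] alone. *)
Lemma het_approx_relative_error alpha eps : 2 < alpha -> 0 < eps ->
  exists K : R, forall c beta sigma2 rex rnet : R,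
    0 < c -> 0 < beta -> 0 < sigma2 -> 0 < rex -> rex < rnet ->
    K <= rnet / rex ->
    `|het_formula c beta sigma2 rex rnet alpha
      - het_approx c beta sigma2 rex rnet alpha|
    <= eps * het_approx c beta sigma2 rex rnet alpha.
Proof.
move=> a2 eps0.
(* If q and w lie in [0, dl], then |q - w| <= dl <= eps / 2 <= eps (1 - q), the last step by q <=
   1/2. *)
pose dl : R := Num.min 2^-1 (eps / 2).
have dl0 : 0 < dl by rewrite lt_min invr_gt0 divr_gt0 ?ltr0n.
have dl1 : dl <= 2^-1 by rewrite ge_min lexx.
have dl2 : dl <= eps / 2 by rewrite ge_min lexx orbT.
pose A (p : R) := dl `^ (p^-1).
have A0 p : 0 < A p by exact: powR_gt0.
(* [A p] is the largest x with x^p <= dl; the sum dominates both inverse thresholds. *)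
exists ((A 2)^-1 + (A (alpha - 2))^-1) => c beta sigma2 rex rnet c0 b0 s0 rex0 rexnet HK.
have rnet0 := lt_trans rex0 rexnet.
set x := rex / rnet.
have x0 : 0 < x by rewrite divr_gt0.
have small p : 0 < p -> (A p)^-1 <= rnet / rex -> x `^ p <= dl.
  move=> p0 h; rewrite -(powR_invK (a := p) (t := dl)) ?gt_eqF ?(ltW dl0)//.
  apply: ge0_ler_powR; rewrite ?nnegrE ?powR_ge0 ?(ltW p0) ?(ltW x0)//.
  by rewrite -/(A p) -lef_pV2 ?posrE// /x invf_div.
have q : x ^+ 2 <= dl.
  rewrite -(powR_mulrn 2 (ltW x0)); apply: small => //.
  by rewrite (le_trans _ HK)// lerDl invr_ge0 ltW.
have w : x `^ (alpha - 2) <= dl.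
  apply: small; first by rewrite subr_gt0.
  by rewrite (le_trans _ HK)// lerDr invr_ge0 ltW.
have app0 := het_approx_gt0 c0 b0 s0 rex0 rnet0 a2.
rewrite het_formula_approx// -/x.
move: (het_approx _ _ _ _ _ _) app0 => B B0.
rewrite -[X in _ - X]mulr1 -mulrBr normrM gtr0_norm// mulrC ler_pM2r//.
have q0 : 0 <= x ^+ 2 by rewrite sqr_ge0.
have w0 : 0 <= x `^ (alpha - 2) by exact: powR_ge0.
move: (x ^+ 2) (x `^ _) q q0 w w0 => q w qd q0 wd w0.
have q1 : 0 < 1 - q by lra.
rewrite (_ : _ - 1 = (q - w) / (1 - q)); last by field; rewrite gt_eqF.
rewrite normrM (gtr0_norm (x := _^-1)) ?invr_gt0// ler_pdivrMr//.
have : `|q - w| <= dl by rewrite ler_norml; apply/andP; split; lra.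
nra.
Qed.

End approximation.

(** * Exact average and assembly of the results *)

Lemma rrs_average_het_gt2 d (T : measurableType d) (R : realType)
    (P : probability T R) (Z : {RV P >-> (R * R)%type}) (G : {RV P >-> R})
    (c beta sigma2 rex rnet alpha : R) :
  0 < c -> 0 < beta -> 0 < sigma2 -> 0 < rex -> rex < rnet -> 2 < alpha ->
  annulus_user Z G sigma2 rex rnet ->
  rrs_average P (output_power c beta alpha (@beacon_distance R \o Z) G)
  = (het_formula c beta sigma2 rex rnet alpha)%:E.
Proof.
move=> c0 b0 s0 rex0 rexnet a2 user.
have a0 : 0 < alpha by rewrite (lt_trans _ a2).
rewrite (rrs_average_het _ _ _ _ user)//; case: user => Zunif _ _.
rewrite (expectation_path_loss_gt2 a0 rex0 rexnet Zunif a2) -EFinM.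
by congr EFin; rewrite /het_formula; ring.
Qed.

Theorem mainTheorem5 (R : realType) (alpha : R) (halpha : 2 <= alpha) :
  (forall (c beta sigma2 rex rnet : R)
      (d : measure_display) (T : measurableType d) (P : probability T R)
      (Z : {RV P >-> (R * R)%type}) (G : {RV P >-> R}),
    0 < c -> 0 < beta -> 0 < sigma2 -> 0 < rex -> rex < rnet ->
    annulus_user Z G sigma2 rex rnet ->
    let Phet := output_power c beta alpha (@beacon_distance R \o Z) G in
    let Psym dist := output_power c beta alpha (cst dist) G in
    [/\ (* exact average output power *)
        2 < alpha ->
          rrs_average P Phet = (het_formula c beta sigma2 rex rnet alpha)%:E,
        (* at alpha = 2 the formula is read by continuity *)
        alpha = 2 ->
          (het_formula c beta sigma2 rex rnet a)%:E @[a --> (2 : R)^']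
            --> rrs_average P Phet,
        (* symmetric users at a common distance, in particular at rex *)
        forall dist : R, 0 < dist ->
          rrs_average P (Psym dist)
            = (c * beta * sigma2 * dist `^ (- alpha))%:E &
        (* equivalent distance *)
        2 < alpha -> forall dbar : R, 0 < dbar ->
          ((het_approx c beta sigma2 rex rnet alpha)%:E
             = rrs_average P (Psym dbar)
           <-> dbar = rex * distance_scaling alpha rex rnet)])
  /\
  (* the approximation for rnet much larger than rex: the relative error tends
     to 0 as rnet / rex tends to infinity *)
  (2 < alpha -> forall eps : R, 0 < eps -> exists K : R,
    forall (c beta sigma2 rex rnet : R)
      (d : measure_display) (T : measurableType d) (P : probability T R)
      (Z : {RV P >-> (R * R)%type}) (G : {RV P >-> R}),
    0 < c -> 0 < beta -> 0 < sigma2 -> 0 < rex -> rex < rnet ->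
    annulus_user Z G sigma2 rex rnet ->
    K <= rnet / rex ->
    let Phet := output_power c beta alpha (@beacon_distance R \o Z) G in
    let Psym dist := output_power c beta alpha (cst dist) G in
    let approx := het_approx c beta sigma2 rex rnet alpha in
    let dbar := rex * distance_scaling alpha rex rnet in
    (`| rrs_average P Phet - approx%:E | <= (eps * approx)%:E)%E
    /\ (`| rrs_average P Phet - rrs_average P (Psym dbar) |
          <= eps%:E * rrs_average P (Psym dbar))%E).
Proof.
split.
  move=> c beta sigma2 rex rnet d T P Z G c0 b0 s0 rex0 rexnet user Phet Psym.
  have rnet0 := lt_trans rex0 rexnet.
  have Gexp : exponential_with_mean G sigma2 by case: user.
  split.
  - by move=> a2; exact: rrs_average_het_gt2.
  - move=> a2; have a0 : 0 < alpha by rewrite a2.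
    rewrite /Phet (rrs_average_het _ _ _ _ user)//; case: user => Zunif _ _.
    rewrite (expectation_path_loss_2 a0 rex0 rexnet Zunif a2) -EFinM.
    by apply: cvg_EFin; [exact: nearW|exact: cvg_het_formula].
  - by move=> dist dist0; exact: rrs_average_sym.
  - move=> a2 dbar dbar0; rewrite /Psym (rrs_average_sym (sigma2 := sigma2))// het_approx_distance//.
    have a0 : 0 < alpha by rewrite (lt_trans _ a2).
    have k0 : 0 < c * beta * sigma2 by rewrite !mulr_gt0.
    split => [[]|<- //].
    (* After cancelling the positive constant, injectivity of the alpha-th power on nonnegative
       reals identifies the two distances. *)
    move=> /(mulfI (lt0r_neq0 k0)); rewrite !powRN => /invr_inj /esym.
    apply: powR_injective => //; rewrite nnegrE ltW//.
    by rewrite mulr_gt0// distance_scaling_gt0.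
move=> a2 eps eps0; have [K HK] := het_approx_relative_error a2 eps0.
exists K => c beta sigma2 rex rnet d T P Z G c0 b0 s0 rex0 rexnet user Kle.
move=> Phet Psym approx dbar.
have rnet0 := lt_trans rex0 rexnet.
have Gexp : exponential_with_mean G sigma2 by case: user.
rewrite /Phet (rrs_average_het_gt2 _ _ _ _ _ _ user)//.
(* The symmetric average at [dbar] is exactly the approximation, so both bounds are the same
   inequality. *)
rewrite /Psym (rrs_average_sym (sigma2 := sigma2))// -het_approx_distance// -EFinM -EFinB lee_fin.
by split; exact: HK.
Qed.
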